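(* Let $\varphi\in\mathcal{S}(\mathbb{R})$ satisfy $\varphi(x)>0$ for all $x$, and let $M_\varphi:L^2(\mathbb{R})\to L^2(\mathbb{R})$ be the multiplication operator $(M_\varphi f)(x)=\varphi(x)f(x)$. Given $g\in L^2(\mathbb{R})$, define for $\lambda>0$ $$R_\lambda g:=(M_\varphi^*M_\varphi+\lambda I)^{-1}M_\varphi^*g.$$ Then: (1) $R_\lambda g$ is the unique minimiser over $h\in L^2(\mathbb{R})$ of the functional $J_\lambda(h)=\|M_\varphi h-g\|_{L^2}^2+\lambda\|h\|_{L^2}^2$. (2) If $g=\varphi f$ with $f\in L^2(\mathbb{R})$, then $R_\lambda g\to f$ in $L^2(\mathbb{R})$ as $\lambda\downarrow0$. (3) If $g=\varphi f$ with $f\in L^2(\mathbb{R})$ and noisy data $g_\delta\in L^2(\mathbb{R})$ satisfy $\|g_\delta-g\|_{L^2}\le\delta$, then $$\|R_\lambda g_\delta-f\|_{L^2}\le\frac{\delta}{2\sqrt\lambda}+\left\|\frac{\lambda}{\varphi^2+\lambda}f\right\|_{L^2}.$$ In particular, if $\lambda=\lambda(\delta)\downarrow0$ and $\delta/\sqrt{\lambda(\delta)}\to0$ as $\delta\downarrow0$, then $R_{\lambda(\delta)}g_\delta\to f$ in $L^2(\mathbb{R})$.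
   Context: $\mathcal{S}(\mathbb{R})$ is the Schwartz space; $I$ is the identity on $L^2(\mathbb{R})$ and $M_\varphi^*$ the Hilbert-space adjoint of $M_\varphi$. *)

(* Defs.v *)
From HB Require Import structures.
From mathcomp Require Import all_boot all_order all_algebra.
From mathcomp Require Import generic_quotient ring_quotient complex.
From mathcomp Require Import all_classical all_reals all_analysis.
From mathcomp Require Import measurable_realfun.

Set Implicit Arguments.
Unset Strict Implicit.
Unset Printing Implicit Defensive.

Import Order.TTheory GRing.Theory Num.Theory.
Import numFieldNormedType.Exports.

Local Open Scope classical_set_scope.
Local Open Scope ring_scope.
Local Open Scope complex_scope.
Local Open Scope quotient_scope.

Definition schwartz (R : realType) (phi : R -> R) : Prop :=
  (forall (n : nat) (x : R), derivable (derive1n n phi) x 1) /\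
  (forall k n : nat, exists C : R,
     forall x : R, `|x ^+ k * derive1n n phi x| <= C).

Section square_integrable.
Context d (T : measurableType d) (R : realType).
Variable mu : {measure set T -> \bar R}.
Implicit Types f g : T -> R[i].

Definition modulus f : T -> R := fun x => Normc.normc (f x).

Definition cmeasurable f : Prop :=
  measurable_fun [set: T] (fun x => complex.Re (f x)) /\
  measurable_fun [set: T] (fun x => complex.Im (f x)).

Definition sqint : {pred T -> R[i]} :=
  mem [set f | cmeasurable f /\ finite_norm mu 2%:E (modulus f)].

Lemma modulusE f x : modulus f x =
  Num.sqrt (complex.Re (f x) ^+ 2 + complex.Im (f x) ^+ 2).
Proof. by rewrite /modulus; case: (f x). Qed.

Lemma modulus_ge0 f x : 0 <= modulus f x.
Proof. by rewrite modulusE sqrtr_ge0. Qed.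

Lemma measurable_modulus f : cmeasurable f ->
  measurable_fun [set: T] (modulus f).
Proof.
move=> [mRe mIm].
rewrite (_ : modulus f = fun x =>
  (complex.Re (f x) ^+ 2 + complex.Im (f x) ^+ 2) `^ 2^-1); last first.
  by apply/funext => x; rewrite modulusE powR12_sqrt// addr_ge0// sqr_ge0.
apply: (measurableT_comp (measurable_powR 2^-1)).
by apply: measurable_funD; apply: measurable_funX.
Qed.

Lemma cmeasurable_lin (a : R[i]) f g : cmeasurable f -> cmeasurable g ->
  cmeasurable (a *: f + g).
Proof.
move=> [fR fI] [gR gI]; split.
- rewrite (_ : (fun x => _) = (fun x =>
      complex.Re a * complex.Re (f x) - complex.Im a * complex.Im (f x)
      + complex.Re (g x))).
    apply: measurable_funD => //; apply: measurable_funB;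
      exact: measurable_funM.
  apply/funext => x; rewrite -[(a *: f + g) x]/(a * f x + g x).
  by case: a (f x) (g x) => [? ?] [? ?] [? ?].
- rewrite (_ : (fun x => _) = (fun x =>
      complex.Re a * complex.Im (f x) + complex.Im a * complex.Re (f x)
      + complex.Im (g x))).
    apply: measurable_funD => //; apply: measurable_funD;
      exact: measurable_funM.
  apply/funext => x; rewrite -[(a *: f + g) x]/(a * f x + g x).
  by case: a (f x) (g x) => [? ?] [? ?] [? ?].
Qed.

Lemma finite_norm_le (h k : T -> R) :
  measurable_fun [set: T] h -> measurable_fun [set: T] k ->
  (forall x, `|h x| <= `|k x|) ->
  finite_norm mu 2%:E k -> finite_norm mu 2%:E h.
Proof.
move=> mh mk hk; rewrite /finite_norm unlock => /lty_poweRy k2.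
apply: poweR_lty; apply: le_lt_trans (k2 _); last by rewrite invr_eq0.
have mpow (u : T -> R) : measurable_fun [set: T] u ->
    measurable_fun [set: T] (fun x => `|(EFin \o u) x| `^ 2)%E.
  move=> mu'; apply: (measurableT_comp (measurable_poweR 2)).
  by apply: measurableT_comp => //; exact/measurable_EFinP.
apply: ge0_le_integral => //.
- by move=> *; exact: poweR_ge0.
- exact: mpow.
- exact: mpow.
- move=> x _; apply: gt0_ler_poweR => //.
  + by rewrite in_itv/= leey lee_fin normr_ge0.
  + by rewrite in_itv/= leey lee_fin normr_ge0.
  + by rewrite /= lee_fin.
Qed.

Lemma sqint_submod_closed : submod_closed sqint.
Proof.
split.
  rewrite inE; split; first by split; exact: measurable_cst.
  rewrite /finite_norm (_ : EFin \o _ = cst 0%E) ?Lnorm0//.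
  by apply/funext => x/=; rewrite modulusE/= expr0n/= addr0 sqrtr0.
move=> a f g; rewrite !inE => -[mf f2] [mg g2].
have mfg := cmeasurable_lin a mf mg; split => //.
have inL h : cmeasurable h -> finite_norm mu 2%:E (modulus h) ->
    modulus h \in Lfun mu 2%:E.
  by move=> mh h2; rewrite !inE/= mem_set ?mem_set//; exact: measurable_modulus.
have h2 : (1 <= 2%:E :> \bar R)%E by rewrite lee_fin ler1n.
have := @Lfun_submod_closed _ _ _ mu 2%:E h2.
move=> [_ /(_ (Normc.normc a) _ _ (inL _ mf f2) (inL _ mg g2))].
rewrite !inE => /andP[]; rewrite !inE => mk k2.
apply: finite_norm_le k2 => //; first exact: measurable_modulus.
move=> x.
rewrite -[X in _ <= `|X|]/(Normc.normc a * modulus f x + modulus g x).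
have na0 : 0 <= Normc.normc a by case: (a) => ? ?; exact: sqrtr_ge0.
rewrite !ger0_norm ?modulus_ge0 ?addr_ge0 ?mulr_ge0 ?modulus_ge0//.
rewrite /modulus -Normc.normcM; exact: le_normcD.
Qed.

HB.instance Definition _ := GRing.isSubmodClosed.Build _ _ sqint
  sqint_submod_closed.

Record L2fun := MkL2fun { L2val :> T -> R[i]; _ : L2val \in sqint }.
HB.instance Definition _ := [isSub for L2val].
HB.instance Definition _ := [Choice of L2fun by <:].
HB.instance Definition _ := [SubChoice_isSubLmodule of L2fun by <:].

(* [L2] is the quotient of [L2fun], the module of square integrable complex
   functions, by its submodule of functions vanishing almost everywhere. *)
Definition L2null : {pred L2fun} :=
  mem [set f : L2fun | \forall x \ae mu, f x = 0].

Lemma L2null_submod_closed : submod_closed L2null.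
Proof.
split; first by rewrite inE; exact: aeW.
move=> a f g; rewrite !inE; apply: filterS2 => x f0 g0.
by rewrite -[LHS]/(a * f x + g x) f0 g0 mulr0 addr0.
Qed.

HB.instance Definition _ := GRing.isSubmodClosed.Build _ _ L2null
  L2null_submod_closed.

Definition L2 : Type := Quotient.quot (L2null : zmodClosed L2fun).
HB.instance Definition _ := Choice.on L2.
HB.instance Definition _ := EqQuotient.on L2.
HB.instance Definition _ := GRing.Zmodule.on L2.

Definition L2scale (a : R[i]) (u : L2) : L2 := \pi_L2 (a *: repr u).

Lemma pi_L2_eq (f g : L2fun) :
  \pi_L2 f = \pi_L2 g <-> (\forall x \ae mu, f x = g x).
Proof.
have -> : (\pi_L2 f = \pi_L2 g) <-> (f - g \in L2null).
  rewrite (Quotient.idealrBE (L2null : zmodClosed L2fun)).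
  by split => [/eqP|/eqP].
rewrite inE; split; apply: filterS => x.
  by move=> /eqP; rewrite -[X in X == _]/(f x - g x) subr_eq0 => /eqP.
by move=> fg; rewrite -[LHS]/(f x - g x) fg subrr.
Qed.

Lemma repr_pi (f : L2fun) : \forall x \ae mu, repr (\pi_L2 f) x = f x.
Proof. by apply/pi_L2_eq; rewrite reprK. Qed.

Lemma pi_L2D (f g : L2fun) : \pi_L2 (f + g) = \pi_L2 f + \pi_L2 g.
Proof. by rewrite [RHS]piE. Qed.

Lemma pi_L2Z a (f : L2fun) : L2scale a (\pi_L2 f) = \pi_L2 (a *: f).
Proof.
apply/pi_L2_eq; apply: filterS (repr_pi f) => x fx.
by rewrite -[LHS]/(a * repr (\pi_L2 f) x) fx.
Qed.

Fact L2scaleA a b u : L2scale a (L2scale b u) = L2scale (a * b) u.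
Proof.
rewrite -[u]reprK; move: (repr u) => f.
by rewrite (pi_L2Z b f) (pi_L2Z a (b *: f)) (pi_L2Z (a * b) f) scalerA.
Qed.

Fact L2scale1 : left_id 1 L2scale.
Proof.
move=> u; rewrite -[u]reprK; move: (repr u) => f.
by rewrite (pi_L2Z 1 f) scale1r.
Qed.

Fact L2scaleDr : right_distributive L2scale +%R.
Proof.
move=> a u v; rewrite -[u]reprK -[v]reprK; move: (repr u) (repr v) => f g.
rewrite -(pi_L2D f g) (pi_L2Z a (f + g)) (pi_L2Z a f) (pi_L2Z a g).
by rewrite -pi_L2D scalerDr.
Qed.

Fact L2scaleDl u : {morph L2scale^~ u : a b / a + b}.
Proof.
move=> a b; rewrite -[u]reprK; move: (repr u) => f.
by rewrite (pi_L2Z (a + b) f) (pi_L2Z a f) (pi_L2Z b f) -pi_L2D scalerDl.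
Qed.

HB.instance Definition _ := GRing.Zmodule_isLmodule.Build R[i] L2
  L2scaleA L2scale1 L2scaleDr L2scaleDl.

(* The class of [f] when [f] is square integrable, and [0] otherwise. *)
Definition L2class (f : T -> R[i]) : L2 := \pi_L2 (insubd (0 : L2fun) f).

Lemma L2classE f : f \in sqint -> \forall x \ae mu, repr (L2class f) x = f x.
Proof.
by move=> f2; have := repr_pi (insubd (0 : L2fun) f); rewrite insubdK.
Qed.

Definition L2norm (u : L2) : R :=
  fine ('N[mu]_2%:E[EFin \o modulus (repr u)])%E.

Definition cintegral (f : T -> R[i]) : R[i] :=
  (\int[mu]_x complex.Re (f x)) +i* (\int[mu]_x complex.Im (f x)).

Definition L2dot (u v : L2) : R[i] :=
  cintegral (fun x => repr u x * (repr v x)^*).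

(* Only meant for bounded measurable [m], see [mulopE]. *)
Definition mulop (m : T -> R) (u : L2) : L2 :=
  L2class (fun x => (m x)%:C * repr u x).

Lemma mulop_sqint (m : T -> R) (C : R) (u : L2) :
  measurable_fun [set: T] m -> (forall x, `|m x| <= C) ->
  (fun x => (m x)%:C * repr u x) \in sqint.
Proof.
move=> mm mC; have C0 : 0 <= C by apply: le_trans (mC point).
have : (repr u : T -> R[i]) \in sqint by case: (repr u).
rewrite !inE => -[mu0 u2]; have [uR uI] := mu0.
have mf : cmeasurable (fun x => (m x)%:C * repr u x).
  split.
  - rewrite (_ : (fun x => _) = fun x => m x * complex.Re (repr u x)).
      exact: measurable_funM.
    by apply/funext => x; case: (repr u x) => a b /=; rewrite mul0r subr0.
  - rewrite (_ : (fun x => _) = fun x => m x * complex.Im (repr u x)).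
      exact: measurable_funM.
    by apply/funext => x; case: (repr u x) => a b /=; rewrite mul0r addr0.
split => //.
have Cu : (fun x => C%:C * repr u x) \in sqint.
  have := rpredZ C%:C (_ : (repr u : T -> R[i]) \in sqint).
  by apply; rewrite inE.
move: Cu; rewrite inE => -[mCu]; apply: finite_norm_le.
- exact: measurable_modulus.
- exact: measurable_modulus.
- move=> x; rewrite !ger0_norm ?modulus_ge0// /modulus !Normc.normcM.
  apply: ler_wpM2r; first by case: (repr u x) => ? ?; exact: sqrtr_ge0.
  by rewrite /= !expr0n/= !addr0 !sqrtr_sqr (ger0_norm C0).
Qed.

Lemma mulopE (m : T -> R) (C : R) (u : L2) :
  measurable_fun [set: T] m -> (forall x, `|m x| <= C) ->
  \forall x \ae mu, repr (mulop m u) x = (m x)%:C * repr u x.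
Proof. by move=> mm mC; apply/L2classE/(mulop_sqint _ mm mC). Qed.

Definition is_adjoint (A B : L2 -> L2) : Prop :=
  forall u v : L2, L2dot (A u) v = L2dot u (B v).

(* An adjoint is unique when it exists; without one, the value is the arbitrary
   default [id]. Same convention for [inverse]. *)
Definition adjoint (A : L2 -> L2) : L2 -> L2 :=
  xget (@id L2) [set B | is_adjoint A B].

Definition is_inverse (A B : L2 -> L2) : Prop := cancel A B /\ cancel B A.

Definition inverse (A : L2 -> L2) : L2 -> L2 :=
  xget (@id L2) [set B | is_inverse A B].

(* A^* A + lambda I *)
Definition normal_op (A : L2 -> L2) (lambda : R) (u : L2) : L2 :=
  adjoint A (A u) + lambda%:C *: u.

Definition regularised (A : L2 -> L2) (lambda : R) (g : L2) : L2 :=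
  inverse (normal_op A lambda) (adjoint A g).

Definition functionalJ (A : L2 -> L2) (g : L2) (lambda : R) (h : L2) : R :=
  L2norm (A h - g) ^+ 2 + lambda * L2norm h ^+ 2.

Definition is_minimiser (J : L2 -> R) (h : L2) : Prop :=
  forall h' : L2, J h <= J h'.

End square_integrable.

Arguments L2 {d T R} mu.
Arguments mulop {d T R} mu m u.

(* Main.v *)
Require Import Defs.
From HB Require Import structures.
From mathcomp Require Import all_boot all_order all_algebra complex.
From mathcomp Require Import all_classical all_reals all_analysis.
From mathcomp Require Import ring measurable_realfun.
Import Order.TTheory GRing.Theory Num.Theory.
Import numFieldNormedType.Exports.
Local Open Scope classical_set_scope.
Local Open Scope ring_scope.
Local Open Scope quotient_scope.
Local Open Scope complex_scope.

Set Implicit Arguments.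
Unset Strict Implicit.
Unset Printing Implicit Defensive.

(**
  Multiplication by a bounded real function is self-adjoint, so the regularised
  inverse is itself multiplication by [phi / (phi^2 + lambda)].  Expanding
  [J_lambda] around the solution [r] of the normal equation kills the cross
  term and gives
  [J_lambda(h) = J_lambda(r) + |M (h - r)|^2 + lambda |h - r|^2].
  The error [R_lambda g_delta - f] splits as
  [R_lambda (g_delta - M f) - lambda / (phi^2 + lambda) f]; the first term is
  bounded since [phi / (phi^2 + lambda) <= 1 / (2 sqrt lambda)], the second
  tends to 0 by dominated convergence, as
  [0 <= lambda / (phi^2 + lambda) <= 1] and [phi] does not vanish.
*)

(** * Componentwise integration of complex-valued functions *)

Section complex_integral.
Context d (T : measurableType d) (R : realType).
Variable mu : {measure set T -> \bar R}.
Implicit Types f g : T -> R[i].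

(** Stated on the two components to match [cintegral], whose real integrals are additive only under
    integrability, infinite values being truncated by [fine]. *)
Definition cintegrable f : Prop :=
  mu.-integrable setT (EFin \o (fun x => complex.Re (f x))) /\
  mu.-integrable setT (EFin \o (fun x => complex.Im (f x))).

Lemma cintegrableD (f g : T -> R[i]) : cintegrable f -> cintegrable g ->
  cintegrable (fun x => f x + g x).
Proof.
move=> [fR fI] [gR gI]; split.
- apply: eq_integrable (integrableD measurableT fR gR) => // x _ /=.
  by case: (f x) (g x) => [? ?] [? ?].
- apply: eq_integrable (integrableD measurableT fI gI) => // x _ /=.
  by case: (f x) (g x) => [? ?] [? ?].
Qed.

Lemma cintegrableZr (a : R) (f : T -> R[i]) : cintegrable f ->
  cintegrable (fun x => a%:C * f x).
Proof.
move=> [fR fI]; split.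
- apply: eq_integrable (integrableZl measurableT a fR) => // x _ /=.
  by case: (f x) => [? ?] /=; rewrite mul0r subr0.
- apply: eq_integrable (integrableZl measurableT a fI) => // x _ /=.
  by case: (f x) => [? ?] /=; rewrite mul0r addr0.
Qed.

Lemma ae_eq_Rintegral (h k : T -> R) :
  mu.-integrable setT (EFin \o h) -> mu.-integrable setT (EFin \o k) ->
  (\forall x \ae mu, h x = k x) -> \int[mu]_x h x = \int[mu]_x k x.
Proof.
move=> /measurable_int mh /measurable_int mk hk; congr fine.
by apply: ae_eq_integral => //; apply: filterS hk => x hkx _ /=; rewrite hkx.
Qed.

Lemma ae_eq_cintegral f g : cintegrable f -> cintegrable g ->
  (\forall x \ae mu, f x = g x) -> cintegral mu f = cintegral mu g.
Proof.
move=> [fR fI] [gR gI] fg; rewrite /cintegral.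
by congr (_ +i* _); apply: ae_eq_Rintegral => //; apply: filterS fg => x ->.
Qed.

Lemma cintegralD f g : cintegrable f -> cintegrable g ->
  cintegral mu (fun x => f x + g x) = cintegral mu f + cintegral mu g.
Proof.
move=> [fR fI] [gR gI]; rewrite /cintegral; simpc; rewrite -!RintegralD//.
by congr (_ +i* _); apply: eq_Rintegral => x _;
  case: (f x) (g x) => [? ?] [? ?].
Qed.

Lemma cintegral_conj f : cintegrable f ->
  cintegral mu (fun x => (f x)^*) = (cintegral mu f)^*.
Proof.
move=> [fR fI]; rewrite /cintegral /=; congr (_ +i* _).
  by apply: eq_Rintegral => x _; case: (f x).
rewrite -mulN1r -RintegralZl//.
by apply: eq_Rintegral => x _; rewrite mulN1r; case: (f x).
Qed.

Lemma cintegralZr (a : R) f : cintegrable f ->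
  cintegral mu (fun x => a%:C * f x) = a%:C * cintegral mu f.
Proof.
move=> [fR fI]; rewrite /cintegral; simpc; rewrite -!RintegralZl//.
by congr (_ +i* _); apply: eq_Rintegral => x _; case: (f x) => [? ?];
  simpc.
Qed.

End complex_integral.

(** * Representatives, inner product and norm on $L^2$ *)

Section L2_inner_product.
Context d (T : measurableType d) (R : realType).
Variable mu : {measure set T -> \bar R}.
Implicit Types u v w : L2 mu.

(** Since [repr] is a section of the quotient map, operator identities reduce to pointwise ones off
    a null set. *)
Lemma L2_ext u v : (\forall x \ae mu, repr u x = repr v x) -> u = v.
Proof. by move=> /pi_L2_eq; rewrite !reprK. Qed.

(** The representative is a choice, so it respects the module operations only almost everywhere. *)
Lemma reprD u v : \forall x \ae mu, repr (u + v) x = repr u x + repr v x.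
Proof.
have := repr_pi (repr u + repr v); rewrite pi_L2D !reprK.
by apply: filterS => x ->.
Qed.

Lemma reprZ a u : \forall x \ae mu, repr (a *: u) x = a * repr u x.
Proof. by have := repr_pi (a *: repr u); apply: filterS => x ->. Qed.

Lemma reprN u : \forall x \ae mu, repr (- u) x = - repr u x.
Proof.
by rewrite -scaleN1r; apply: filterS (reprZ (-1) u) => x ->; rewrite mulN1r.
Qed.

Lemma repr0 : \forall x \ae mu, repr (0 : L2 mu) x = 0.
Proof.
by rewrite -(scale0r 0); apply: filterS (reprZ 0 0) => x ->; rewrite mul0r.
Qed.

Lemma repr_sqint u : cmeasurable (repr u) /\
  finite_norm mu 2%:E (modulus (repr u)).
Proof.
by have : (repr u : T -> R[i]) \in sqint mu; [case: (repr u)|rewrite inE].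
Qed.

Lemma normr_Re_le_modulus (f : T -> R[i]) x :
  `|complex.Re (f x)| <= `|modulus f x|.
Proof.
rewrite (ger0_norm (modulus_ge0 _ _)) modulusE -sqrtr_sqr ler_sqrt ?sqr_ge0//.
  by rewrite lerDl sqr_ge0.
by rewrite addr_ge0// sqr_ge0.
Qed.

Lemma normr_Im_le_modulus (f : T -> R[i]) x :
  `|complex.Im (f x)| <= `|modulus f x|.
Proof.
rewrite (ger0_norm (modulus_ge0 _ _)) modulusE -sqrtr_sqr ler_sqrt ?sqr_ge0//.
  by rewrite lerDr sqr_ge0.
by rewrite addr_ge0// sqr_ge0.
Qed.

Lemma modulus_Lfun u : modulus (repr u) \in Lfun mu 2%:E.
Proof.
have [mu0 u2] := repr_sqint u.
by rewrite inE; apply/andP; split; rewrite inE//=; exact: measurable_modulus.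
Qed.

Lemma Re_Lfun u : (fun x => complex.Re (repr u x)) \in Lfun mu 2%:E.
Proof.
have [mu0 u2] := repr_sqint u.
rewrite inE; apply/andP; split; rewrite inE/=; first by case: mu0.
apply: finite_norm_le u2; [by case: mu0|exact: measurable_modulus|].
exact: normr_Re_le_modulus.
Qed.

Lemma Im_Lfun u : (fun x => complex.Im (repr u x)) \in Lfun mu 2%:E.
Proof.
have [mu0 u2] := repr_sqint u.
rewrite inE; apply/andP; split; rewrite inE/=; first by case: mu0.
apply: finite_norm_le u2; [by case: mu0|exact: measurable_modulus|].
exact: normr_Im_le_modulus.
Qed.

(** The components of $u\bar v$ are sums and differences of products of real square integrable
    functions, and each such product is in $L^1$. *)
Lemma L2dot_integrable u v : cintegrable mu (fun x => repr u x * (repr v x)^*).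
Proof.
split.
- have := integrableD measurableT
    ((Lfun1_integrable _ _).1 (Lfun2_mul_Lfun1 (Re_Lfun u) (Re_Lfun v)))
    ((Lfun1_integrable _ _).1 (Lfun2_mul_Lfun1 (Im_Lfun u) (Im_Lfun v))).
  apply: eq_integrable => // x _ /=.
  by case: (repr u x) (repr v x) => [a b] [a' b'] /=; rewrite mulrN opprK.
- have := integrableB measurableT
    ((Lfun1_integrable _ _).1 (Lfun2_mul_Lfun1 (Im_Lfun u) (Re_Lfun v)))
    ((Lfun1_integrable _ _).1 (Lfun2_mul_Lfun1 (Re_Lfun u) (Im_Lfun v))).
  apply: eq_integrable => // x _ /=.
  case: (repr u x) (repr v x) => [a b] [a' b'] /=.
  by rewrite -EFinB mulrN addrC.
Qed.

Lemma L2dotDl u v w : L2dot (u + v) w = L2dot u w + L2dot v w.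
Proof.
rewrite /L2dot -cintegralD; try exact: L2dot_integrable.
apply: ae_eq_cintegral; first exact: L2dot_integrable.
  by apply: cintegrableD; exact: L2dot_integrable.
by apply: filterS (reprD u v) => x ->; rewrite mulrDl.
Qed.

Lemma L2dotC u v : L2dot v u = (L2dot u v)^*.
Proof.
rewrite /L2dot -cintegral_conj; last exact: L2dot_integrable.
congr cintegral; apply/funext => x.
by rewrite rmorphM /= conjcK mulrC.
Qed.

Lemma L2dotDr u v w : L2dot u (v + w) = L2dot u v + L2dot u w.
Proof. by rewrite (L2dotC (v + w)) (L2dotC v) (L2dotC w) L2dotDl rmorphD. Qed.

Lemma L2dotZr (a : R) u v : L2dot u (a%:C *: v) = a%:C * L2dot u v.
Proof.
rewrite /L2dot -cintegralZr; last exact: L2dot_integrable.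
apply: ae_eq_cintegral; first exact: L2dot_integrable.
  by apply: cintegrableZr; exact: L2dot_integrable.
apply: filterS (reprZ a%:C v) => x ->.
case: (repr u x) (repr v x) => [b c] [b' c'] /=; simpc.
by congr (_ +i* _); ring.
Qed.

Lemma L2dotBr u v w : L2dot u (v - w) = L2dot u v - L2dot u w.
Proof.
by apply/esym/eqP; rewrite subr_eq -L2dotDr subrK.
Qed.

Lemma L2norm_ge0 u : 0 <= L2norm u.
Proof. by rewrite /L2norm fine_ge0// Lnorm_ge0. Qed.

Lemma L2norm_fin u :
  (L2norm u)%:E = ('N[mu]_2%:E[EFin \o modulus (repr u)])%E.
Proof.
have [_ u2] := repr_sqint u.
by rewrite /L2norm fineK// ge0_fin_numE ?Lnorm_ge0.
Qed.

(** Replaces the norm by an ordinary integral, on which comparison and dominated convergence act. *)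
Lemma L2norm_sqr u : L2norm u ^+ 2 = \int[mu]_x modulus (repr u) x ^+ 2.
Proof.
apply: EFin_inj; rewrite -powR_mulrn ?L2norm_ge0// -poweR_EFin L2norm_fin.
rewrite poweR_Lnorm ?pnatr_eq0//.
rewrite /Rintegral fineK; last first.
  apply: integrable_fin_num => //.
  exact: (Lfun2_integrable_sqr (modulus_Lfun u)).
apply: eq_integral => x _ /=.
by rewrite ger0_norm ?modulus_ge0// powR_mulrn ?modulus_ge0.
Qed.

Lemma L2dot_norm u : L2dot u u = (L2norm u ^+ 2)%:C.
Proof.
rewrite L2norm_sqr /L2dot /cintegral /real_complex_def.
congr (_ +i* _).
  apply: eq_Rintegral => x _; rewrite modulusE sqr_sqrtr.
    by case: (repr u x) => a b /=; rewrite mulrN opprK !expr2.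
  by rewrite addr_ge0// sqr_ge0.
(* The imaginary part of $u\bar u$ vanishes pointwise; 0 is written as $0\cdot\mu(T)$ to become the
   integral of a constant. *)
rewrite -[RHS](mul0r (fine (mu setT))) -Rintegral_cst//.
apply: eq_Rintegral => x _.
by case: (repr u x) => a b /=; rewrite mulrN mulrC addNr.
Qed.

Lemma L2norm_eq0 u : L2norm u = 0 -> u = 0.
Proof.
move=> u0; have [/measurable_modulus mu0 _] := repr_sqint u.
have := L2norm_fin u; rewrite u0 => /esym.
have m2 : measurable_fun setT (EFin \o modulus (repr u)).
  exact/measurable_EFinP.
have p2 : (0 < 2%:E :> \bar R)%E by rewrite lte_fin.
move=> /(Lnorm_eq0_eq0 m2 p2) u00; apply: L2_ext.
apply: filterS2 u00 repr0 => x /= /(_ I) h ->.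
by case: h => /ComplexField.Normc.eq0_normc.
Qed.

Lemma L2norm_ler_ae u v :
  (\forall x \ae mu, modulus (repr u) x <= modulus (repr v) x) ->
  L2norm u <= L2norm v.
Proof.
move=> uv; rewrite -(ler_pXn2r (n:=2))// ?nnegrE ?L2norm_ge0// !L2norm_sqr.
apply: fine_le.
- apply: integrable_fin_num => //.
  exact: (Lfun2_integrable_sqr (modulus_Lfun u)).
- apply: integrable_fin_num => //.
  exact: (Lfun2_integrable_sqr (modulus_Lfun v)).
apply: ae_ge0_le_integral => //=.
- by move=> x _; rewrite lee_fin sqr_ge0.
- by apply: (measurable_int mu); exact: (Lfun2_integrable_sqr (modulus_Lfun u)).
- by move=> x _; rewrite lee_fin sqr_ge0.
- by apply: (measurable_int mu); exact: (Lfun2_integrable_sqr (modulus_Lfun v)).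
apply: filterS uv => x uv _.
by rewrite lee_fin ler_pXn2r// nnegrE modulus_ge0.
Qed.

(** Minkowski's inequality bounds the norm of the sum of the moduli; the pointwise triangle
    inequality and monotonicity of the norm compare it with the modulus of the sum. *)
Lemma L2normD u v : L2norm (u + v) <= L2norm u + L2norm v.
Proof.
rewrite -lee_fin EFinD !L2norm_fin.
have mm w : measurable_fun setT (modulus (repr w)).
  by have [/measurable_modulus] := repr_sqint w.
apply: le_trans (minkowski_EFin _ (mm u) (mm v) _) => //; last by rewrite ler1n.
rewrite unlock; apply: gt0_ler_poweR => //.
- by rewrite in_itv/= leey integral_ge0// => x _; exact: poweR_ge0.
- by rewrite in_itv/= leey integral_ge0// => x _; exact: poweR_ge0.
have mpow (h : T -> R) : measurable_fun setT h ->
    measurable_fun setT (fun x => `|(EFin \o h) x| `^ 2)%E.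
  move=> mh; apply: (measurableT_comp (measurable_poweR 2)).
  by apply: measurableT_comp => //; exact/measurable_EFinP.
apply: ae_ge0_le_integral => //.
- by move=> *; exact: poweR_ge0.
- exact: mpow.
- by move=> *; exact: poweR_ge0.
- by apply: mpow; exact: measurable_funD.
apply: filterS (reprD u v) => x h _.
apply: gt0_ler_poweR => //.
- by rewrite in_itv/= leey lee_fin normr_ge0.
- by rewrite in_itv/= leey lee_fin normr_ge0.
rewrite /= lee_fin !ger0_norm ?addr_ge0 ?modulus_ge0// /modulus h.
exact: le_normcD.
Qed.

Lemma L2normN u : L2norm (- u) = L2norm u.
Proof.
by apply/eqP; rewrite eq_le; apply/andP; split; apply: L2norm_ler_ae;
  apply: filterS (reprN u) => x; rewrite /modulus => ->; rewrite normcN.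
Qed.

Lemma L2normB u v : L2norm (u - v) <= L2norm u + L2norm v.
Proof. by rewrite -(L2normN v); exact: L2normD. Qed.

(** * Uniqueness of adjoints and inverses *)

Lemma L2_eqP u v : (forall w, L2dot w u = L2dot w v) -> u = v.
Proof.
move=> uv; apply/eqP; rewrite -subr_eq0; apply/eqP; apply: L2norm_eq0.
(* Testing against $w=u-v$ gives $\|u-v\|^2=0$. *)
have := L2dotBr (u - v) u v; rewrite uv subrr L2dot_norm => /eqP.
by rewrite eq_complex /= eqxx andbT sqrf_eq0 => /eqP.
Qed.

Lemma is_adjoint_uniq (A B B' : L2 mu -> L2 mu) :
  is_adjoint A B -> is_adjoint A B' -> B =1 B'.
Proof. by move=> AB AB' v; apply: L2_eqP => u; rewrite -AB -AB'. Qed.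

Lemma is_inverse_uniq (A B B' : L2 mu -> L2 mu) :
  is_inverse A B -> is_inverse A B' -> B =1 B'.
Proof. by move=> [AB BA] [AB' _] v; rewrite -{2}(BA v) AB'. Qed.

(** By uniqueness, exhibiting one adjoint determines the value chosen by [xget] and rules out the
    default. *)
Lemma adjointP (A B : L2 mu -> L2 mu) : is_adjoint A B -> adjoint A = B.
Proof.
move=> AB; rewrite /adjoint; case: xgetP => [B' -> AB'|/(_ B)//].
by apply/funext; exact: is_adjoint_uniq AB' AB.
Qed.

Lemma inverseP (A B : L2 mu -> L2 mu) : is_inverse A B -> inverse A = B.
Proof.
move=> AB; rewrite /inverse; case: xgetP => [B' -> AB'|/(_ B)//].
by apply/funext; exact: is_inverse_uniq AB' AB.
Qed.

(** * Expansion of the quadratic functional *)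

Lemma L2norm_sqrD u v :
  L2norm (u + v) ^+ 2 =
  L2norm u ^+ 2 + L2norm v ^+ 2 + 2 * complex.Re (L2dot v u).
Proof.
have : complex.Re (L2dot (u + v) (u + v)) = L2norm (u + v) ^+ 2.
  by rewrite L2dot_norm.
rewrite L2dotDl !L2dotDr (L2dotC v u) !L2dot_norm /= => <-.
case: (L2dot v u) => a b /=; ring.
Qed.

Lemma functionalJ_normal (A B : L2 mu -> L2 mu) (g r h : L2 mu) (lambda : R) :
  (forall u v, A (u + v) = A u + A v) -> is_adjoint A B ->
  (forall u v, B (u - v) = B u - B v) ->
  B (A r) + lambda%:C *: r = B g ->
  functionalJ A g lambda h = functionalJ A g lambda r +
    (L2norm (A (h - r)) ^+ 2 + lambda * L2norm (h - r) ^+ 2).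
Proof.
move=> AD AB BB Br; rewrite /functionalJ.
have [k ->] : exists k, h = r + k by exists (h - r); rewrite addrC subrK.
have -> : r + k - r = k by rewrite addrAC subrr add0r.
rewrite AD addrAC !L2norm_sqrD AB BB.
(* Twice the real part of this number is the cross term of the expansion: moving $A$ across the
   inner product gives $\langle k, B(Ar-g)+\lambda r\rangle$, whose second argument is zero by the
   normal equation. *)
have : L2dot k (B (A r) - B g) + lambda%:C * L2dot k r = 0.
  rewrite -L2dotZr -L2dotDr -Br opprD addrA subrr add0r addNr.
  by have := L2dotBr k 0 0; rewrite !subrr.
case: (L2dot k (B (A r) - B g)) (L2dot k r) => [a b] [a' b'] /= [].
rewrite mul0r subr0 => H _; apply/eqP; rewrite -subr_eq0; apply/eqP.
rewrite -[RHS](mulr0 2) -H; ring.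
Qed.

End L2_inner_product.

(** * Multiplication by bounded real functions *)

Section multiplication_operators.
Context d (T : measurableType d) (R : realType).
Variable mu : {measure set T -> \bar R}.
Implicit Types (m n : T -> R) (u v : L2 mu).

(** For these multipliers the product stays square integrable, so [mulop] does not fall back on the
    default 0 of [L2class]. *)
Definition bounded_mfun m : Prop :=
  measurable_fun setT m /\ exists C, forall x, `|m x| <= C.

Lemma bounded_mfun_cst c : bounded_mfun (cst c).
Proof. by split => //; exists `|c|. Qed.

Lemma bounded_mfunD m n : bounded_mfun m -> bounded_mfun n ->
  bounded_mfun (fun x => m x + n x).
Proof.
move=> [mm [C mC]] [mn [D nD]]; split; first exact: measurable_funD.
by exists (C + D) => x; apply: le_trans (ler_normD _ _) _; exact: lerD.
Qed.

Lemma bounded_mfunM m n : bounded_mfun m -> bounded_mfun n ->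
  bounded_mfun (fun x => m x * n x).
Proof.
move=> [mm [C mC]] [mn [D nD]]; split; first exact: measurable_funM.
by exists (C * D) => x; rewrite normrM ler_pM.
Qed.

Lemma repr_mulop m u : bounded_mfun m ->
  \forall x \ae mu, repr (mulop mu m u) x = (m x)%:C * repr u x.
Proof. by move=> [mm [C mC]]; exact: mulopE mm mC. Qed.

Lemma modulus_mulop m u : bounded_mfun m ->
  \forall x \ae mu,
    modulus (repr (mulop mu m u)) x = `|m x| * modulus (repr u) x.
Proof.
move=> /(@repr_mulop m u); apply: filterS => x; rewrite /modulus => ->.
by rewrite Normc.normcM /= expr0n/= addr0 sqrtr_sqr.
Qed.

Lemma mulopD m u v : bounded_mfun m ->
  mulop mu m (u + v) = mulop mu m u + mulop mu m v.
Proof.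
move=> bm; apply: L2_ext; near=> x.
rewrite (near (reprD (mulop mu m u) (mulop mu m v)) x)//.
rewrite (near (repr_mulop (u + v) bm) x)// (near (reprD u v) x)//.
by rewrite (near (repr_mulop u bm) x)// (near (repr_mulop v bm) x)// mulrDr.
Unshelve. all: by end_near. Qed.

Lemma mulopN m u : bounded_mfun m -> mulop mu m (- u) = - mulop mu m u.
Proof.
move=> bm; apply: L2_ext; near=> x.
rewrite (near (reprN (mulop mu m u)) x)//.
rewrite (near (repr_mulop (- u) bm) x)// (near (reprN u) x)//.
by rewrite (near (repr_mulop u bm) x)// mulrN.
Unshelve. all: by end_near. Qed.

Lemma mulopB m u v : bounded_mfun m ->
  mulop mu m (u - v) = mulop mu m u - mulop mu m v.
Proof. by move=> bm; rewrite mulopD// mulopN. Qed.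

Lemma mulop_add m n u : bounded_mfun m -> bounded_mfun n ->
  mulop mu m u + mulop mu n u = mulop mu (fun x => m x + n x) u.
Proof.
move=> bm bn; apply: L2_ext; near=> x.
rewrite (near (reprD (mulop mu m u) (mulop mu n u)) x)//.
rewrite (near (repr_mulop u (bounded_mfunD bm bn)) x)//.
rewrite (near (repr_mulop u bm) x)// (near (repr_mulop u bn) x)//.
by rewrite rmorphD mulrDl.
Unshelve. all: by end_near. Qed.

(** With [mulop_add] and [mulop_cst], this makes [mulop] a functional calculus: operator identities
    become scalar identities between multipliers. *)
Lemma mulop_comp m n u : bounded_mfun m -> bounded_mfun n ->
  mulop mu m (mulop mu n u) = mulop mu (fun x => m x * n x) u.
Proof.
move=> bm bn; apply: L2_ext; near=> x.
rewrite (near (repr_mulop (mulop mu n u) bm) x)//.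
rewrite (near (repr_mulop u (bounded_mfunM bm bn)) x)//.
by rewrite (near (repr_mulop u bn) x)// mulrA rmorphM.
Unshelve. all: by end_near. Qed.

Lemma mulop_cst c u : mulop mu (cst c) u = c%:C *: u.
Proof.
apply: L2_ext; near=> x.
rewrite (near (repr_mulop u (bounded_mfun_cst c)) x)//.
by rewrite (near (reprZ c%:C u) x).
Unshelve. all: by end_near. Qed.

(** A real factor is fixed by conjugation, so it moves freely between the two arguments of the inner
    product. *)
Lemma mulop_adjoint m : bounded_mfun m ->
  is_adjoint (mulop mu m) (mulop mu m).
Proof.
move=> bm u v; apply: ae_eq_cintegral; [exact: L2dot_integrable..|].
near=> x; rewrite (near (repr_mulop u bm) x)// (near (repr_mulop v bm) x)//.
case: (repr u x) (repr v x) => [b c] [b' c'] /=; simpc.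
by congr (_ +i* _); ring.
Unshelve. all: by end_near. Qed.

Lemma L2norm_mulop m u C : bounded_mfun m -> (forall x, `|m x| <= C) ->
  L2norm (mulop mu m u) <= C * L2norm u.
Proof.
(* Nonnegativity of the bound is read off at the distinguished point of [T]. *)
move=> bm mC; have C0 : 0 <= C by apply: le_trans (mC point).
rewrite -(ler_pXn2r (n:=2))// ?nnegrE ?mulr_ge0 ?L2norm_ge0//.
rewrite exprMn !L2norm_sqr -RintegralZl//; last first.
  exact: (Lfun2_integrable_sqr (modulus_Lfun u)).
have iu : mu.-integrable setT
    (EFin \o (fun x => C ^+ 2 * modulus (repr u) x ^+ 2)).
  exact: (integrableZl measurableT _ (Lfun2_integrable_sqr (modulus_Lfun u))).
have im := Lfun2_integrable_sqr (modulus_Lfun (mulop mu m u)).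
apply: fine_le; [exact: integrable_fin_num..|].
apply: ae_ge0_le_integral => //=.
- by move=> x _; rewrite lee_fin sqr_ge0.
- exact: (measurable_int mu).
- by move=> x _; rewrite lee_fin mulr_ge0// sqr_ge0.
- exact: (measurable_int mu).
apply: filterS (modulus_mulop u bm) => x -> _.
rewrite lee_fin -exprMn ler_pXn2r ?nnegrE ?mulr_ge0 ?modulus_ge0//.
by rewrite ler_wpM2r ?modulus_ge0.
Qed.

(** Dominated convergence for the integrands $|m_k u|^2$, with majorant $C^2|u|^2$. *)
Lemma mulop_cvg0 (m_ : nat -> T -> R) (C : R) u :
  (forall k, measurable_fun setT (m_ k)) -> (forall k x, `|m_ k x| <= C) ->
  (forall x, m_ k x @[k --> \oo] --> 0) ->
  L2norm (mulop mu (m_ k) u) @[k --> \oo] --> 0.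
Proof.
move=> mm mC m0.
have bm k : bounded_mfun (m_ k) by split => //; exists C.
have iu := Lfun2_integrable_sqr (modulus_Lfun u).
pose F k x := (modulus (repr (mulop mu (m_ k) u)) x ^+ 2)%:E.
have iF k : mu.-integrable setT (F k).
  exact: (Lfun2_integrable_sqr (modulus_Lfun _)).
(* Each $k$ has its own exceptional null set; their countable union is still null. *)
have aeF : \forall x \ae mu, forall k,
    modulus (repr (mulop mu (m_ k) u)) x = `|m_ k x| * modulus (repr u) x.
  by apply/ae_foralln => k; exact: modulus_mulop.
have ig : mu.-integrable setT
    (fun x => (C ^+ 2)%:E * (modulus (repr u) x ^+ 2)%:E)%E.
  exact: integrableZl.
have Fg : {ae mu, forall x k, setT x ->
    (`|F k x| <= (C ^+ 2)%:E * (modulus (repr u) x ^+ 2)%:E)%E}.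
  apply: filterS aeF => x Fx k _; rewrite /F Fx exprMn.
  rewrite gee0_abs ?lee_fin ?mulr_ge0 ?exprn_ge0 ?modulus_ge0//.
  rewrite ler_wpM2r ?sqr_ge0// ler_pXn2r ?nnegrE//.
  by apply: le_trans (mC k x).
have F0 : {ae mu, forall x, setT x -> F ^~ x @ \oo --> 0%E}.
  apply: filterS aeF => x Fx _.
  have -> : F ^~ x =
      EFin \o (fun k => m_ k x ^+ 2 * modulus (repr u) x ^+ 2).
    by apply/funext => k; rewrite /F Fx/= exprMn real_normK ?num_real.
  apply: cvg_EFin; first exact: nearW.
  rewrite -[X in _ --> X](mul0r (modulus (repr u) x ^+ 2)).
  apply: cvgM; last exact: cvg_cst.
  by rewrite -(mulr0 0); apply: cvgM; exact: m0.
have [_ _] := dominated_convergence measurableT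
  (fun k => measurable_int mu (iF k)) (measurable_cst _) F0 ig Fg.
rewrite integral0 => /fine_cvg /= cF.
(* Convergence of the squared norms passes to the norms by continuity of the square root. *)
have -> : (fun k => L2norm (mulop mu (m_ k) u)) =
    (fun k => Num.sqrt (\int[mu]_x modulus (repr (mulop mu (m_ k) u)) x ^+ 2)).
  by apply/funext => k; rewrite -L2norm_sqr sqrtr_sqr ger0_norm// L2norm_ge0.
rewrite -[X in _ --> X]sqrtr0.
by apply: continuous_cvg; [exact: sqrt_continuous|exact: cF].
Qed.

End multiplication_operators.

(** * Tikhonov regularisation of a multiplication operator *)

Section tikhonov.
Context d (T : measurableType d) (R : realType).
Variable mu : {measure set T -> \bar R}.
Variable phi : T -> R.
Hypothesis bphi : bounded_mfun phi.
Implicit Types (u v f g h : L2 mu) (lambda : R).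

Local Notation M := (mulop mu phi).
(** The multiplier of $R_\lambda$; [bias] below is, up to sign, the multiplier of the error on exact
    data. *)
Definition gain lambda x := phi x / (phi x ^+ 2 + lambda).
Definition bias lambda x := lambda / (phi x ^+ 2 + lambda).

Let den_gt0 lambda x : 0 < lambda -> 0 < phi x ^+ 2 + lambda.
Proof. by move=> l0; rewrite ltr_wpDl// sqr_ge0. Qed.

Lemma bounded_mfun_resolvent lambda : 0 < lambda ->
  bounded_mfun (fun x => (phi x ^+ 2 + lambda)^-1).
Proof.
move=> l0; split.
  have [mphi _] := bphi.
  apply: (measurableT_comp (f := fun t : R => (t ^+ 2 + lambda)^-1)) => //.
  apply: continuous_measurable_fun => t; apply: cvgV.
    by rewrite gt_eqF// ltr_wpDl// sqr_ge0.
  by apply: cvgD; [exact: exprn_continuous|exact: cvg_cst].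
(* The denominator is at least $\lambda$. *)
exists lambda^-1 => x; have d0 := den_gt0 x l0.
rewrite ger0_norm ?invr_ge0 ?(ltW d0)//.
by rewrite lef_pV2 ?posrE ?den_gt0// lerDr sqr_ge0.
Qed.

Let bphi2 : bounded_mfun (fun x => phi x ^+ 2).
Proof. exact: (bounded_mfunM bphi bphi). Qed.

Let bden lambda : bounded_mfun (fun x => phi x ^+ 2 + lambda).
Proof. exact: bounded_mfunD bphi2 (bounded_mfun_cst _ lambda). Qed.

Let bgain lambda : 0 < lambda -> bounded_mfun (gain lambda).
Proof.
by move=> l0; exact: (bounded_mfunM bphi (bounded_mfun_resolvent l0)).
Qed.

Let bbias lambda : 0 < lambda -> bounded_mfun (bias lambda).
Proof.
move=> l0.
exact: (bounded_mfunM (bounded_mfun_cst _ lambda) (bounded_mfun_resolvent l0)).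
Qed.

Lemma adjoint_mulop : adjoint M = M.
Proof. by apply: adjointP; exact: mulop_adjoint. Qed.

Lemma normal_op_mulop lambda :
  normal_op M lambda = mulop mu (fun x => phi x ^+ 2 + lambda).
Proof.
apply/funext => u; rewrite /normal_op adjoint_mulop -mulop_cst mulop_comp//.
by rewrite mulop_add//; exact: bounded_mfun_cst.
Qed.

(** The normal operator is multiplication by $\varphi^2+\lambda>0$, hence inverted by multiplication
    by the bounded reciprocal. *)
Lemma normal_op_inverse lambda : 0 < lambda ->
  is_inverse (normal_op M lambda)
    (mulop mu (fun x => (phi x ^+ 2 + lambda)^-1)).
Proof.
move=> l0; have br := bounded_mfun_resolvent l0; rewrite normal_op_mulop.
split=> u; rewrite mulop_comp//.
  rewrite (_ : (fun x => _) = cst 1) ?mulop_cst ?scale1r//.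
  by apply/funext => x; rewrite mulVf// gt_eqF// den_gt0.
rewrite (_ : (fun x => _) = cst 1) ?mulop_cst ?scale1r//.
by apply/funext => x; rewrite mulfV// gt_eqF// den_gt0.
Qed.

Lemma regularisedE lambda g : 0 < lambda ->
  regularised M lambda g = mulop mu (gain lambda) g.
Proof.
move=> l0; rewrite /regularised (inverseP (normal_op_inverse l0)) adjoint_mulop.
rewrite mulop_comp//; last exact: bounded_mfun_resolvent.
by congr mulop; apply/funext => x; rewrite /gain mulrC.
Qed.

Lemma functionalJ_regularised lambda g h : 0 < lambda ->
  functionalJ M g lambda h = functionalJ M g lambda (regularised M lambda g) +
    (L2norm (M (h - regularised M lambda g)) ^+ 2 +
     lambda * L2norm (h - regularised M lambda g) ^+ 2).
Proof.
move=> l0; apply: (functionalJ_normal (B := M)).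
- by move=> u v; exact: mulopD.
- exact: mulop_adjoint.
- by move=> u v; exact: mulopB.
- rewrite -[LHS]/(M (M _) + _) -{1}adjoint_mulop -[LHS]/(normal_op M lambda _).
  (* The right-inverse property [K] says that $R_\lambda g$ solves the normal equation. *)
  have [_ K] := normal_op_inverse l0.
  by rewrite /regularised (inverseP (normal_op_inverse l0)) K adjoint_mulop.
Qed.

Lemma regularised_minimiser lambda g : 0 < lambda ->
  is_minimiser (functionalJ M g lambda) (regularised M lambda g).
Proof.
move=> l0 h; rewrite (functionalJ_regularised g h l0) lerDl.
by rewrite addr_ge0 ?sqr_ge0// mulr_ge0 ?sqr_ge0// ltW.
Qed.

(** For a minimiser the excess $\|M(h-r)\|^2+\lambda\|h-r\|^2$, where $r=R_\lambda g$, is at most 0;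
    as $\lambda>0$, this forces $h=r$. *)
Lemma minimiser_regularised lambda g h : 0 < lambda ->
  is_minimiser (functionalJ M g lambda) h -> h = regularised M lambda g.
Proof.
move=> l0 /(_ (regularised M lambda g)).
rewrite (functionalJ_regularised g h l0) gerDl => Jh.
apply/eqP; rewrite -subr_eq0; apply/eqP/L2norm_eq0/eqP; rewrite -sqrf_eq0.
rewrite eq_le sqr_ge0 andbT -(pmulr_rle0 _ l0).
by apply: le_trans Jh; rewrite lerDr sqr_ge0.
Qed.

(** The scalar identity is $\varphi^2/(\varphi^2+\lambda)+\lambda/(\varphi^2+\lambda)=1$. *)
Lemma regularised_exact lambda f : 0 < lambda ->
  regularised M lambda (M f) - f = - mulop mu (bias lambda) f.
Proof.
move=> l0; apply/eqP; rewrite subr_eq addrC -subr_eq opprK; apply/eqP.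
rewrite regularisedE// (mulop_comp _ (bgain l0) bphi).
rewrite (mulop_add _ (bounded_mfunM (bgain l0) bphi) (bbias l0)).
rewrite (_ : (fun x => _) = cst 1) ?mulop_cst ?scale1r//.
apply/funext => x; rewrite /bias /gain /=.
by have := den_gt0 x l0; move=> /gt_eqF/negbT ?; field.
Qed.

Lemma normr_bias_le1 lambda x : 0 < lambda -> `|bias lambda x| <= 1.
Proof.
move=> l0; have d0 := den_gt0 x l0.
rewrite /bias ger0_norm ?divr_ge0 ?(ltW d0) ?(ltW l0)//.
by rewrite ler_pdivrMr ?den_gt0// mul1r lerDr sqr_ge0.
Qed.

(* AM-GM: [2 |phi| sqrt lambda <= phi^2 + lambda]. *)
Lemma normr_gain_le lambda x : 0 < lambda ->
  `|gain lambda x| <= (2 * Num.sqrt lambda)^-1.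
Proof.
move=> l0; rewrite /gain normrM normfV (gtr0_norm (den_gt0 x l0)).
have s0 : 0 < Num.sqrt lambda by rewrite sqrtr_gt0.
rewrite ler_pdivrMr ?den_gt0// mulrC ler_pdivlMr ?mulr_gt0//.
rewrite -subr_ge0 -{1}(sqr_sqrtr (ltW l0)) -(real_normK (num_real (phi x))).
by rewrite (_ : _ - _ = (`|phi x| - Num.sqrt lambda) ^+ 2) ?sqr_ge0//; ring.
Qed.

Lemma regularised_cvg f : (forall x, phi x != 0) ->
  L2norm (regularised M lambda (M f) - f) @[lambda --> 0^'+] --> (0 : R).
Proof.
(* The right-hand limit is tested along positive sequences tending to 0, to which [mulop_cvg0]
   applies. *)
move=> phi0; apply/cvg_at_rightP => l [l0 cl].
under eq_fun do rewrite regularised_exact// L2normN.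
apply: (mulop_cvg0 (C := 1)) => [k|k x|x].
- by have [] := bbias (l0 k).
- exact: normr_bias_le1.
(* The pointwise limit is $0/(\varphi(x)^2+0)$, legitimate because $\varphi(x)\ne0$. *)
rewrite -(mul0r (phi x ^+ 2 + 0)^-1); apply: cvgM => //; apply: cvgV.
  by rewrite addr0 expf_neq0.
by apply: cvgD => //; exact: cvg_cst.
Qed.

Lemma regularised_error f g (delta lambda : R) : 0 < lambda ->
  L2norm (g - M f) <= delta ->
  L2norm (regularised M lambda g - f) <=
    delta / (2 * Num.sqrt lambda) + L2norm (mulop mu (bias lambda) f).
Proof.
move=> l0 gd.
have -> : regularised M lambda g - f =
    mulop mu (gain lambda) (g - M f) - mulop mu (bias lambda) f.
  rewrite -regularised_exact// (mulopB _ _ (bgain l0)) !regularisedE//.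
  by rewrite addrA subrK.
apply: le_trans (L2normB _ _) _; rewrite lerD2r.
apply: le_trans (L2norm_mulop _ (bgain l0) (fun x => normr_gain_le x l0)) _.
by rewrite mulrC ler_wpM2r// invr_ge0 mulr_ge0// sqrtr_ge0.
Qed.

Lemma regularised_noisy_cvg f (g_ : R -> L2 mu) (lambda : R -> R) :
  (forall x, phi x != 0) ->
  (forall delta, 0 < delta -> L2norm (g_ delta - M f) <= delta) ->
  lambda delta @[delta --> 0^'+] --> (0 : R)^'+ ->
  delta / Num.sqrt (lambda delta) @[delta --> 0^'+] --> (0 : R) ->
  L2norm (regularised M (lambda delta) (g_ delta) - f) @[delta --> 0^'+]
    --> (0 : R).
Proof.
move=> phi0 gd cl cd.
(* Convergence to [0^'+], rather than to the neighbourhoods of 0, carries eventual positivity. *)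
have lgt0 : \forall delta \near (0 : R)^'+, 0 < lambda delta.
  exact: (cl _ (nbhs_right_gt (0 : R))).
(* The majorant for the squeeze: noise bound plus error on exact data, the latter having the same
   norm as the bias term of [regularised_error]. *)
pose E delta := delta / Num.sqrt (lambda delta) / 2 +
  L2norm (regularised M (lambda delta) (M f) - f).
have cE : E delta @[delta --> 0^'+] --> (0 : R).
  rewrite -[X in _ --> X](addr0 0); apply: cvgD.
    rewrite -[X in _ --> X](mul0r 2^-1).
    by apply: cvgM; [exact: cd|exact: cvg_cst].
  exact: (cvg_comp _ _ cl (regularised_cvg f phi0)).
apply: (squeeze_cvgr _ (cvg_cst 0) cE); near=> delta.
have l0 : 0 < lambda delta by near: delta.
have d0 : 0 < delta by near: delta; exact: nbhs_right_gt.
rewrite L2norm_ge0 /E regularised_exact// L2normN /=.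
by have := regularised_error l0 (gd _ d0); rewrite invfM mulrA (mulrAC delta).
Unshelve. all: by end_near. Qed.

End tikhonov.

(** * Schwartz multipliers on the real line *)

Lemma schwartz_bounded_mfun (R : realType) (phi : R -> R) :
  schwartz phi -> bounded_mfun phi.
Proof.
move=> [dphi bphi]; split.
  apply: continuous_measurable_fun => x; apply: differentiable_continuous.
  exact/derivable1_diffP/(dphi 0%N x).
(* The seminorm with $k=n=0$ is the supremum bound; above, differentiability at order 0 gave
   continuity, hence measurability. *)
by have [C hC] := bphi 0%N 0%N; exists C => x; have := hC x; rewrite mul1r.
Qed.

Theorem theoremC1 (R : realType) (phi : R -> R)
    (phi_schwartz : schwartz phi) (phi_gt0 : forall x : R, 0 < phi x) :
  let L2R := L2 (@lebesgue_measure R) in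
  let M : L2R -> L2R := mulop (@lebesgue_measure R) phi in
  let Reg : R -> L2R -> L2R := regularised M in
  [/\
   (* the adjoint and the inverse in the definition of [Reg] exist *)
   is_adjoint M (adjoint M) /\
   (forall lambda : R, 0 < lambda ->
      is_inverse (normal_op M lambda) (inverse (normal_op M lambda))),
   (* (1) *)
   forall (g : L2R) (lambda : R), 0 < lambda ->
     is_minimiser (functionalJ M g lambda) (Reg lambda g) /\
     (forall h : L2R,
        is_minimiser (functionalJ M g lambda) h -> h = Reg lambda g),
   (* (2) *)
   forall f : L2R,
     L2norm (Reg lambda (M f) - f) @[lambda --> (0 : R)^'+] --> (0 : R),
   (* (3), error bound *)
   forall (f g_delta : L2R) (delta lambda : R), 0 < lambda ->
     L2norm (g_delta - M f) <= delta ->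
     L2norm (Reg lambda g_delta - f) <=
       delta / (2 * Num.sqrt lambda) +
       L2norm (mulop (@lebesgue_measure R)
                 (fun x : R => lambda / (phi x ^+ 2 + lambda)) f)
   (* (3), convergence *)
   & forall (f : L2R) (g_ : R -> L2R) (lambda : R -> R),
     (forall delta : R, 0 < delta -> L2norm (g_ delta - M f) <= delta) ->
     lambda delta @[delta --> (0 : R)^'+] --> (0 : R)^'+ ->
     delta / Num.sqrt (lambda delta) @[delta --> (0 : R)^'+] --> (0 : R) ->
     L2norm (Reg (lambda delta) (g_ delta) - f) @[delta --> (0 : R)^'+]
       --> (0 : R)].
Proof.
move=> L2R M Reg; have bphi := schwartz_bounded_mfun phi_schwartz.
have phi0 x : phi x != 0 by rewrite gt_eqF.
split.
(* Explicit multiplication operators serve as witnesses, so neither [adjoint] nor [inverse] takes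
   its default value in [Reg] for positive $\lambda$. *)
- split; first by rewrite /M adjoint_mulop//; exact: mulop_adjoint.
  move=> lambda l0; have K := normal_op_inverse (@lebesgue_measure R) bphi l0.
  by rewrite (inverseP K).
- by move=> g lambda l0; split;
    [exact: regularised_minimiser|move=> h; exact: minimiser_regularised].
- by move=> f; exact: regularised_cvg.
- by move=> f g delta lambda; exact: regularised_error.
- by move=> f g_ lambda; exact: regularised_noisy_cvg.
Qed.
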